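(* Let $\phi:\mathbb{R}^n\to\mathbb{R}$ be convex and differentiable with $\rho^{-1}$-Lipschitz continuous gradient for some $\rho>0$, and let $\psi:\mathbb{R}^n\to\mathbb{R}$ be (possibly nonconvex and) Fréchet differentiable with $L$-Lipschitz continuous gradient for some $L>0$. Let $x_0,v_0\in\mathbb{R}^n$ and $\lambda>0$ be such that $v_0=\nabla\phi(x_0)$. Let $(x,v):[0,+\infty)\to\mathbb{R}^n\times\mathbb{R}^n$ be the unique strong global solution of the dynamical system $$\begin{cases} v(t)=\nabla\phi(x(t))\\ \lambda\dot x(t)+\dot v(t)+\nabla\phi(x(t))+\nabla\psi(x(t))=0\\ x(0)=x_0,\ v(0)=v_0=\nabla\phi(x_0).\end{cases}$$ Suppose that $x$ is bounded and that $\phi+\psi$ is bounded from below and is a KL function whose KL property holds with functions of the form $\varphi(s)=Cs^{1-\theta}$, where $C>0$ and $\theta\in(0,1)$. Then there exists $\overline{x}\in\mathbb{R}^n$ with $\nabla(\phi+\psi)(\overline{x})=0$ such that $\lim_{t\to+\infty}x(t)=\overline{x}$ and $\lim_{t\to+\infty}v(t)=\nabla\phi(\overline{x})=-\nabla\psi(\overline{x})$. Moreover, let $\theta\in(0,1)$ be the Łojasiewicz exponent of $\phi+\psi$ at $\overline{x}$, i.e. there exist $C,\varepsilon>0$ such that $$|(\phi+\psi)(u)-(\phi+\psi)(\overline{x})|^{\theta}\le C\|\nabla(\phi+\psi)(u)\|\quad\text{for every } u \text{ with } \|u-\overline{x}\|<\varepsilon.$$ Then there exist $a_1,b_1,a_2,b_2>0$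 and $t_0\ge 0$ such that for every $t\ge t_0$ the following statements are true: (i) if $\theta\in(0,\tfrac12)$, then $x$ and $v$ converge in finite time; (ii) if $\theta=\tfrac12$, then $\|x(t)-\overline{x}\|+\|v(t)-\nabla\phi(\overline{x})\|\le a_1\exp(-b_1t)$; (iii) if $\theta\in(\tfrac12,1)$, then $\|x(t)-\overline{x}\|+\|v(t)-\nabla\phi(\overline{x})\|\le (a_2t+b_2)^{-\frac{1-\theta}{2\theta-1}}$.
   Context: $\mathbb{R}^n$ carries the Euclidean scalar product $\langle\cdot,\cdot\rangle$ and norm $\|\cdot\|$. A function $x:[0,+\infty)\to\mathbb{R}^n$ is locally absolutely continuous if it is absolutely continuous on every interval $[0,T]$, $T>0$. A pair $(x,v)$ is a strong global solution of the system if: $x,v:[0,+\infty)\to\mathbb{R}^n$ are locally absolutely continuous; $v(t)=\nabla\phi(x(t))$ for every $t\ge 0$; $\lambda\dot x(t)+\dot v(t)+v(t)+\nabla\psi(x(t))=0$ for almost every $t\ge 0$; and $x(0)=x_0$, $v(0)=v_0$. (Existence and uniqueness of a strong global solution are known under these assumptions.) KL property with $\varphi(s)=Cs^{1-\theta}$, for the continuously differentiable function $f=\phi+\psi$: at every $\overline{u}\in\mathbb{R}^n$ there exist $\eta\in(0,+\infty]$, a neighborhood $U$ of $\overline{u}$ and $\varphi:[0,\eta)\to[0,+\infty)$ of the form $\varphi(s)=Cs^{1-\theta}$ with $C>0$, $\theta\in(0,1)$, such that for all $u\in U$ with $f(\overline{u})<f(u)<f(\overline{u})+\eta$ one has $\varphi'(f(u)-f(\overline{u}))\,\|\nabla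 f(u)\|\ge 1$. ''$x$ and $v$ converge in finite time'' means that there is $T\ge 0$ such that $x$ and $v$ are constant on $[T,+\infty)$ (so $x(t)=\overline{x}$ and $v(t)=\nabla\phi(\overline{x})$ for all $t\ge T$). *)

(* Defs.v *)
From HB Require Import structures.
From mathcomp Require Import all_boot all_order all_algebra.
From mathcomp Require Import all_classical all_reals all_analysis.
Set Implicit Arguments.
Unset Strict Implicit.
Unset Printing Implicit Defensive.
Import Order.TTheory GRing.Theory Num.Theory.
Import numFieldNormedType.Exports.
Local Open Scope classical_set_scope.
Local Open Scope ring_scope.

(* The norm of the normedModType 'rV[R]_n is the max norm.  It induces the
   Euclidean topology, so limits, boundedness and differentiability are taken
   from the library; every quantitative estimate uses enorm instead. *)
Definition dotv (R : realType) (n : nat) (u w : 'rV[R]_n) : R :=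
  \sum_(i < n) u ord0 i * w ord0 i.

Definition enorm (R : realType) (n : nat) (u : 'rV[R]_n) : R :=
  Num.sqrt (dotv u u).

Definition grad (R : realType) (n : nat) (f : 'rV[R]_n -> R) (u : 'rV[R]_n) :
  'rV[R]_n := \row_(i < n) 'D_(delta_mx ord0 i) f u.

(* grad is the Riesz representative of the differential with respect to dotv. *)
Lemma diff_grad (R : realType) (n : nat) (f : 'rV[R]_n -> R)
    (u h : 'rV[R]_n) :
  differentiable f u -> 'd f u h = dotv (grad f u) h.
Proof.
move=> df; rewrite {1}(row_sum_delta h) linear_sum /dotv.
apply: eq_bigr => i _.
by rewrite linearZ/= mxE deriveE // mulrC.
Qed.

Definition elipschitz (R : realType) (n : nat) (k : R)
    (g : 'rV[R]_n -> 'rV[R]_n) : Prop :=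
  forall u w : 'rV[R]_n, enorm (g u - g w) <= k * enorm (u - w).

Definition absolutely_continuous (R : realType) (n : nat) (a b : R)
    (f : R -> 'rV[R]_n) : Prop :=
  forall e : R, 0 < e -> exists2 d : R, 0 < d &
    forall (m : nat) (l r : 'I_m -> R),
      (forall i, [/\ a <= l i, l i <= r i & r i <= b]) ->
      trivIset [set: 'I_m] (fun i => `]l i, r i[%classic) ->
      \sum_(i < m) (r i - l i) < d ->
      \sum_(i < m) enorm (f (r i) - f (l i)) < e.

(* Functions on [0, +oo[ are encoded as functions on R whose values at negative
   arguments are never constrained. *)
Definition locally_absolutely_continuous (R : realType) (n : nat)
    (f : R -> 'rV[R]_n) : Prop :=
  forall T : R, 0 < T -> absolutely_continuous 0 T f.

(* The derivatives below are two-sided; 0, where this would involve negative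
   times, is negligible.  Since derive1 is total, that it is a genuine derivative
   is stated as part of the differential equation. *)
Definition strong_global_solution (R : realType) (n : nat)
    (phi psi : 'rV[R]_n -> R) (lambda : R) (x0 v0 : 'rV[R]_n)
    (x v : R -> 'rV[R]_n) : Prop :=
  [/\ locally_absolutely_continuous x /\ locally_absolutely_continuous v,
      forall t : R, 0 <= t -> v t = grad phi (x t),
      {ae (@lebesgue_measure R), forall t : R, 0 <= t ->
         [/\ derivable x t 1, derivable v t 1 &
             lambda *: derive1 x t + derive1 v t + v t + grad psi (x t) = 0]},
      x 0 = x0 &
      v 0 = v0].

Definition desingularizing (R : realType) (C theta : R) (s : R) : R :=
  C * s `^ (1 - theta).

Definition KL_power_at (R : realType) (n : nat) (f : 'rV[R]_n -> R)
    (ubar : 'rV[R]_n) : Prop :=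
  exists (eta : \bar R) (U : set 'rV[R]_n) (C theta : R),
    [/\ (0 < eta)%E, nbhs ubar U, 0 < C, 0 < theta < 1 &
      forall u : 'rV[R]_n, U u ->
        f ubar < f u -> ((f u)%:E < (f ubar)%:E + eta)%E ->
        1 <= derive1 (desingularizing C theta) (f u - f ubar) * enorm (grad f u)].

Definition KL_power_function (R : realType) (n : nat) (f : 'rV[R]_n -> R) :
  Prop := forall ubar : 'rV[R]_n, KL_power_at f ubar.

Definition lojasiewicz_exponent (R : realType) (n : nat) (f : 'rV[R]_n -> R)
    (ubar : 'rV[R]_n) (theta : R) : Prop :=
  exists C eps : R, [/\ 0 < C, 0 < eps &
    forall u : 'rV[R]_n, enorm (u - ubar) < eps ->
      `|f u - f ubar| `^ theta <= C * enorm (grad f u)].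

Definition converges_in_finite_time (R : realType) (n : nat)
    (y : R -> 'rV[R]_n) (ybar : 'rV[R]_n) : Prop :=
  exists2 T : R, 0 <= T & forall t : R, T <= t -> y t = ybar.

(* Main.v *)
Require Import Defs.
From HB Require Import structures.
From mathcomp Require Import all_boot all_order all_algebra.
From mathcomp Require Import all_classical all_reals all_analysis.
From mathcomp Require Import ring lra.
Set Implicit Arguments.
Unset Strict Implicit.
Unset Printing Implicit Defensive.
Import Order.TTheory GRing.Theory Num.Theory.
Import numFieldNormedType.Exports.
Local Open Scope classical_set_scope.
Local Open Scope ring_scope.

(** Write f = phi + psi. Almost everywhere lambda x' + v' = - grad f (x), with
    v = grad phi (x). Convexity of phi gives <x', v'> >= 0 and the Lipschitz
    bound gives |v'| <= rho^-1 |x'|, hence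
    <<
      d/dt f (x t) = <grad f (x), x'> <= - lambda |x'|^2     (decrease)
      |grad f (x)| <= (lambda + rho^-1) |x'|                 (relative error).
    >>
    These two inequalities are all that is kept of the system; convergence and
    rates are proved for any curve that satisfies them, a [descent_curve].

    Absolute continuity is needed to pass from almost-everywhere inequalities to
    increments. Every function that has to be integrated
    is Lipschitz as a function of x, so it suffices to know that a real function
    whose increments are dominated by those of an absolutely continuous curve,
    and whose derivative is a.e. at most k, grows at rate at most k
    ([ae_derive1_le_incr]). This is proved by a covering argument on the real
    line, without integration. For a desingularizing function H and a level c it
    is applied to t |-> <w, x t> + H (f (x t) - c) with a fixed vector w, which
    bounds displacements without differentiating a norm ([energy_comparison]).

    A bounded curve has a limit point xbar, and f (x t) decreases to f xbar. If
    the value f xbar is attained in finite time, the curve stops there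
    ([stationary], [finite_time]). Otherwise the KL inequality says that
    H (f (x t) - f xbar) decreases at least at a fixed multiple of the speed
    |x'| as long as x t stays near xbar ([desingularized_length]). The length
    still to be travelled is then so small that the curve cannot leave the
    neighbourhood ([trapped]); hence x t tends to xbar, and grad f vanishes
    there because f (x t) is bounded below ([gradient_limit0]).

    For the rates put e t = f (x t) - f xbar. The Lojasiewicz inequality with
    exponent theta gives |x t - xbar| = O (e t ^ (1 - theta)) and
    - e' >= k e ^ (2 theta), i.e. e ^ (1 - 2 theta) / (1 - 2 theta), or ln e when
    theta = 1/2, decreases at least linearly. For theta < 1/2 that quantity is
    nonnegative, so e reaches 0 in finite time; the two other cases give the
    exponential and the power rate. Finally
    |v t - grad phi xbar| <= rho^-1 |x t - xbar|. *)

(** * Euclidean geometry of row vectors *)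

Section euclidean.
Variables (R : realType) (n : nat).
Implicit Types (u w : 'rV[R]_n) (a : R).

Lemma dotvC u w : dotv u w = dotv w u.
Proof. by apply: eq_bigr => i _; rewrite mulrC. Qed.

Lemma dotvDr u w1 w2 : dotv u (w1 + w2) = dotv u w1 + dotv u w2.
Proof. by rewrite -big_split; apply: eq_bigr => i _; rewrite mxE mulrDr. Qed.

Lemma dotvZr u a w : dotv u (a *: w) = a * dotv u w.
Proof. by rewrite /dotv mulr_sumr; apply: eq_bigr => i _; rewrite mxE mulrCA. Qed.

Lemma dotvDl u1 u2 w : dotv (u1 + u2) w = dotv u1 w + dotv u2 w.
Proof. by rewrite !(dotvC _ w) dotvDr. Qed.

Lemma dotvZl a u w : dotv (a *: u) w = a * dotv u w.
Proof. by rewrite !(dotvC _ w) dotvZr. Qed.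

Lemma dotv0l u : dotv 0 u = 0.
Proof. by rewrite -(scale0r 0) dotvZl mul0r. Qed.

Lemma dotvNr u w : dotv u (- w) = - dotv u w.
Proof. by rewrite -scaleN1r dotvZr mulN1r. Qed.

Lemma dotvNl u w : dotv (- u) w = - dotv u w.
Proof. by rewrite dotvC dotvNr dotvC. Qed.

Lemma dotvBr u w1 w2 : dotv u (w1 - w2) = dotv u w1 - dotv u w2.
Proof. by rewrite dotvDr dotvNr. Qed.

Lemma dotvBl u1 u2 w : dotv (u1 - u2) w = dotv u1 w - dotv u2 w.
Proof. by rewrite dotvDl dotvNl. Qed.

Lemma dotv_ge0 u : 0 <= dotv u u.
Proof. by apply: sumr_ge0 => i _; rewrite -expr2 sqr_ge0. Qed.

Lemma enorm_ge0 u : 0 <= enorm u.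
Proof. exact: sqrtr_ge0. Qed.

Lemma sqr_enorm u : enorm u ^+ 2 = dotv u u.
Proof. by rewrite sqr_sqrtr ?dotv_ge0. Qed.

Lemma enorm0_eq0 u : enorm u = 0 -> u = 0.
Proof.
move=> u0; have /eqP := sqr_enorm u.
rewrite u0 expr0n /= eq_sym psumr_eq0 => [/allP z|i _]; last first.
  by rewrite -expr2 sqr_ge0.
apply/rowP => i; have := z i (mem_index_enum i).
by rewrite mulf_eq0 orbb mxE => /eqP.
Qed.

Lemma enorm0 : enorm (0 : 'rV[R]_n) = 0.
Proof. by rewrite /enorm -(scale0r 0) dotvZr mul0r sqrtr0. Qed.

Lemma enormZ a u : enorm (a *: u) = `|a| * enorm u.
Proof.
by rewrite /enorm dotvZr dotvZl mulrA -expr2 sqrtrM ?sqr_ge0// sqrtr_sqr.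
Qed.

Lemma enormN u : enorm (- u) = enorm u.
Proof. by rewrite /enorm dotvNr dotvNl opprK. Qed.

Lemma enormB u w : enorm (u - w) = enorm (w - u).
Proof. by rewrite -enormN opprB. Qed.

Lemma cauchy_schwarz u w : dotv u w <= enorm u * enorm w.
Proof.
have [w0|w0] := eqVneq (enorm w) 0.
  have /enorm0_eq0-> := w0.
  by rewrite enorm0 mulr0 -(scale0r 0) dotvZr mul0r.
have {}w0 : 0 < enorm w by rewrite lt_def w0 enorm_ge0.
have := dotv_ge0 (enorm w ^+ 2 *: u - dotv u w *: w).
rewrite !(dotvBl, dotvBr, dotvZl, dotvZr) (dotvC w u) -!sqr_enorm.
rewrite [X in 0 <= X](_ : _ =
  enorm w ^+ 2 * ((enorm u * enorm w) ^+ 2 - dotv u w ^+ 2)); last by ring.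
rewrite pmulr_rge0 ?exprn_gt0// subr_ge0 => h.
have [|] := leP (dotv u w) 0.
  by move=> /le_trans; apply; rewrite mulr_ge0 ?enorm_ge0.
by move=> /ltW p; rewrite -(@ler_pXn2r _ 2) ?nnegrE ?mulr_ge0 ?enorm_ge0.
Qed.

Lemma normr_dotv_le u w : `|dotv u w| <= enorm u * enorm w.
Proof.
rewrite ler_norml cauchy_schwarz andbT lerNl -dotvNl -(enormN u).
exact: cauchy_schwarz.
Qed.

Lemma enormD u w : enorm (u + w) <= enorm u + enorm w.
Proof.
rewrite -(@ler_pXn2r _ 2) ?nnegrE ?addr_ge0 ?enorm_ge0//.
rewrite sqr_enorm !(dotvDl, dotvDr) (dotvC w u) -!sqr_enorm sqrrD.
have := cauchy_schwarz u w; lra.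
Qed.

Lemma normr_le_enorm u : `|u| <= enorm u.
Proof.
rewrite [leLHS]/Num.Def.normr/= mx_normrE; apply: bigmax_le; first exact: enorm_ge0.
move=> [i j] _ /=; rewrite (ord1 i) -sqrtr_sqr ler_sqrt ?dotv_ge0//.
rewrite /dotv (bigD1 j)//= -expr2 lerDl.
by apply: sumr_ge0 => k _; rewrite -expr2 sqr_ge0.
Qed.

Lemma enorm_le_normr u : enorm u <= n%:R * `|u|.
Proof.
rewrite -(@ler_pXn2r _ 2) ?nnegrE ?mulr_ge0 ?enorm_ge0//.
rewrite sqr_enorm exprMn.
apply: (@le_trans _ _ (\sum_(i < n) `|u| ^+ 2)).
  apply: ler_sum => i _; rewrite -expr2 -real_normK ?num_real//.
  rewrite ler_pXn2r ?nnegrE// [leRHS]/Num.Def.normr/= mx_normrE.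
  exact: (le_bigmax _ (fun ij : 'I_1 * 'I_n => `|u ij.1 ij.2|) (ord0, i)).
rewrite sumr_const card_ord -[leLHS]mulr_natl ler_wpM2r ?sqr_ge0//.
by rewrite -natrX ler_nat; case: n => // k; rewrite expnS expn1 leq_pmulr.
Qed.

Lemma enorm_lt_nbhs u e : 0 < e -> nbhs u [set w | enorm (w - u) < e].
Proof.
move=> e0; apply/nbhs_ballP; exists (e / n.+1%:R) => /=.
  by rewrite divr_gt0.
move=> w; rewrite -ball_normE /= ltr_pdivlMr// => h; rewrite enormB.
apply: le_lt_trans (enorm_le_normr _) (le_lt_trans _ h).
by rewrite mulrC ler_wpM2l// ler_nat.
Qed.

Lemma nbhs_enorm_lt u (U : set 'rV[R]_n) : nbhs u U ->
  exists2 e : R, 0 < e & forall w, enorm (w - u) < e -> U w.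
Proof.
move=> /nbhs_ballP[e /= e0 h]; exists e => // w we; apply: h.
rewrite -ball_normE /=.
by apply: le_lt_trans (normr_le_enorm _) _; rewrite enormB.
Qed.

Lemma cvg_enormP (T : Type) (F : set_system T) {FF : Filter F}
    (f : T -> 'rV[R]_n) u :
  (forall e : R, 0 < e -> \forall t \near F, enorm (f t - u) < e) -> f @ F --> u.
Proof.
move=> h; apply/cvgrPdist_lt => e e0; apply: filterS (h e e0) => t.
by rewrite enormB; apply: le_lt_trans; exact: normr_le_enorm.
Qed.

Lemma cvg_dotv (T : Type) (F : set_system T) {FF : Filter F}
    (f g : T -> 'rV[R]_n) u w :
  f @ F --> u -> g @ F --> w -> dotv (f t) (g t) @[t --> F] --> dotv u w.
Proof.
move=> fu gw.
apply: cvg_big => [|i _]; first exact: add_continuous.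
by apply: cvgM; [move: fu | move: gw] => h;
  apply: (cvg_comp _ (fun M : 'rV[R]_n => M ord0 i) h); exact: coord_continuous.
Qed.

Lemma cvg_enorm (T : Type) (F : set_system T) {FF : Filter F}
    (f : T -> 'rV[R]_n) u :
  f @ F --> u -> enorm (f t) @[t --> F] --> enorm u.
Proof.
by move=> fu; apply: (cvg_comp _ Num.sqrt (cvg_dotv fu fu)); exact: sqrt_continuous.
Qed.

Lemma elipschitz_continuous k (g : 'rV[R]_n -> 'rV[R]_n) :
  elipschitz k g -> continuous g.
Proof.
move=> gk u; apply: (@cvg_enormP _ _ (nbhs_filter u)) => e e0.
have k0 : 0 < `|k| + 1 by rewrite ltr_wpDl.
apply: filterS (enorm_lt_nbhs u (divr_gt0 e0 k0)) => w /=.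
rewrite ltr_pdivlMr// mulrC; apply: le_lt_trans (le_trans (gk _ _) _).
by rewrite ler_wpM2r ?enorm_ge0// (le_trans (ler_norm _))// lerDl.
Qed.

End euclidean.

(** * Growth of functions from an almost-everywhere bound on the derivative *)

Section almost_everywhere_derivative.
Variable R : realType.
Implicit Types (F : R -> R) (a b k : R).

(** Continuous induction. It plays the role of Cousin's lemma: a bound for small
    intervals around each point is glued into a bound on the whole interval
    without having to handle tagged partitions. *)
Lemma interval_induction (P : R -> Prop) a b : a <= b -> P a ->
  (forall t, a <= t <= b -> exists2 d : R, 0 < d &
     forall l r : R, a <= l -> t - d < l -> l <= t ->
       t <= r -> r < t + d -> r <= b -> P l -> P r) ->
  P b.
Proof.
move=> ab Pa step; pose S := [set t | a <= t <= b /\ P t].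
have Sa : S a by split=> //; rewrite lexx.
have Sub : ubound S b by move=> t [/andP[]].
have hS : has_sup S by split; [exists a | exists b].
have aS : a <= sup S by apply: ub_le_sup => //; exists b.
have Sb : sup S <= b by apply: ge_sup => //; exists a.
have [|d d0 hd] := step (sup S); first by rewrite aS.
have [l [/andP[al lb] Pl] ldS] := sup_adherent d0 hS.
have lS : l <= sup S by apply: ub_le_sup; [exists b | split=> //; rewrite al].
pose r := Num.min b (sup S + d / 2).
have Sr : sup S <= r by rewrite le_min Sb lerDl divr_ge0// ltW.
have rd : r < sup S + d.
  by rewrite gt_min; apply/orP; right; rewrite ltrD2l; lra.
have rb : r <= b by rewrite ge_min lexx.
have Pr : P r by exact: hd Pl.
have rS : r <= sup S.
  by apply: ub_le_sup; [exists b | split=> //; rewrite rb (le_trans aS)].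
move: rS Pr; rewrite /r; case: (leP b (sup S + d / 2)) => // _; lra.
Qed.

Lemma derive1_quotient (V : normedModType R) (g : R -> V) t :
  derivable g t 1 -> h^-1 *: (g (h + t) - g t) @[h --> 0^'] --> derive1 g t.
Proof.
move=> dg; rewrite derive1E; suff -> : (fun h => h^-1 *: (g (h + t) - g t)) =
  (fun h => h^-1 *: ((g \o shift t) (h *: 1) - g t)) by [].
by apply/funext => h /=; rewrite [h *: 1]mulr1.
Qed.

Lemma derive1_le_incr F t k e : derivable F t 1 -> derive1 F t <= k -> 0 < e ->
  exists2 d : R, 0 < d & forall l r : R, t - d < l -> l <= t -> t <= r -> r < t + d ->
    F r - F l <= (k + e) * (r - l).
Proof.
move=> dF Fk e0; have := derive1_quotient dF.
move=> /cvgrPdist_lt/(_ e e0)/nbhs_ballP[d /= d0 hd].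
have q h : h != 0 -> `|h| < d -> h^-1 * (F (h + t) - F t) < k + e.
  move=> h0 hhd; have := hd h; rewrite -ball_normE/= sub0r normrN => /(_ hhd h0).
  by rewrite ltr_norml => /andP[+ _]; rewrite /GRing.scale/=; lra.
have right r : t <= r -> r < t + d -> F r - F t <= (k + e) * (r - t).
  rewrite le_eqVlt => /predU1P[->|tr rd]; first by rewrite !subrr mulr0.
  have rt : 0 < r - t by rewrite subr_gt0.
  have := q (r - t); rewrite gt_eqF// subrK gtr0_norm// => /(_ isT).
  by rewrite ltr_pdivrMl// mulrC => h; apply/ltW/h; lra.
have left l : t - d < l -> l <= t -> F t - F l <= (k + e) * (t - l).
  rewrite le_eqVlt => ld /predU1P[->|lt]; first by rewrite !subrr mulr0.
  have lt0 : l - t < 0 by rewrite subr_lt0.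
  have := q (l - t); rewrite lt_eqF// subrK ltr0_norm// => /(_ isT).
  rewrite ltr_ndivrMl// => h; have : (l - t) * (k + e) < F l - F t by apply: h; lra.
  lra.
exists d => // l r tl lt tr rt; have := right _ tr rt; have := left _ tl lt; lra.
Qed.

Lemma disjoint_intervals_length_le m (l r : 'I_m -> R) (U : set R) :
  measurable U -> (forall i, l i <= r i) -> (forall i, `]l i, r i[ `<=` U) ->
  trivIset setT (fun i => `]l i, r i[%classic) ->
  ((\sum_(i < m) (r i - l i))%:E <= @lebesgue_measure R U)%E.
Proof.
move=> mU lr lrU tI.
have mI i : measurable (`]l i, r i[%classic : set R) by exact: measurable_itv.
rewrite -sumEFin (_ : (\sum_(i < m) _)%E =
    (\sum_(i < m) @lebesgue_measure R `]l i, r i[%classic)%E); last first.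
  apply: eq_bigr => i _; rewrite lebesgue_measure_itv/= lte_fin.
  have := lr i; rewrite le_eqVlt => /predU1P[->|->//].
  by rewrite ltxx subrr.
rewrite -measure_bigsetU_ord//; apply: le_measure; rewrite ?inE//.
  exact: bigsetU_measurable.
by elim/big_ind: _ => [//|A B AU BU|i _]; [rewrite subUset | exact: lrU].
Qed.

(** Domination by an absolutely continuous curve [y] is closed under sums and
    under composition with Lipschitz functions, so it is easier to check for
    composites than absolute continuity of [F] itself. Let the exceptional null
    set be covered by an open set U of small measure. A small interval around
    a point outside U contributes at most (k + e) times its length; one around a
    point of U may be taken inside U, and all of those together have small
    total length, hence contribute little. *)
Lemma ae_derive1_le_incr (n : nat) (y : R -> 'rV[R]_n) F a b k K :
  a <= b -> 0 <= K -> absolutely_continuous a b y ->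
  (forall s t : R, a <= s <= b -> a <= t <= b ->
     `|F s - F t| <= K * enorm (y s - y t)) ->
  {ae @lebesgue_measure R, forall t : R, a <= t <= b ->
     derivable F t 1 /\ derive1 F t <= k} ->
  F b - F a <= k * (b - a).
Proof.
move=> ab K0 acy FK [N [mN N0 badN]].
pose C := K + `|k| + 1.
have C0 : 0 < C by rewrite ltr_wpDl// addr_ge0.
suff main e : 0 < e -> e <= 1 -> F b - F a <= (k + e) * (b - a) + C * e.
  apply/ler_addgt0Pr => e e0.
  have c0 : 0 < b - a + C by rewrite ltr_wpDl// subr_ge0.
  have m0 : 0 < Num.min 1 (e / (b - a + C)) by rewrite lt_min ltr01 divr_gt0.
  have := main _ m0; rewrite ge_min lexx => /(_ isT).
  have : Num.min 1 (e / (b - a + C)) * (b - a + C) <= e.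
    by rewrite -ler_pdivlMr// ge_min lexx orbT.
  lra.
move=> e0 e1; have [d' d'0 acd] := acy e e0.
(* d <= e makes the compensating terms small as well *)
pose d := Num.min d' e; have d0 : 0 < d by rewrite lt_min d'0.
have Noo : (@lebesgue_measure R N < +oo)%E by rewrite N0 ltry.
have [U [oU NU mUN]] := lebesgue_regularity_outer mN Noo d0.
have mU : measurable U by exact: measurable_realfun.open_measurable.
have Ud : (@lebesgue_measure R U < d%:E)%E.
  have := @measureU2 _ _ _ (@lebesgue_measure R) _ _ (measurableD mU mN) mN.
  rewrite setDKU// [X in (_ + X)%E](_ : _ = 0%E); last exact: N0.
  by rewrite adde0 => /le_lt_trans; exact.
(* The intervals listed in P are the ones inside U collected so far, ordered
   from left to right; the term `|k + e| * (r i - l i) compensates for the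
   increase of (k + e) * (t - a) across them when k is negative. *)
pose P t := exists m (l r : nat -> R),
  [/\ forall i, (i < m)%N ->
        [/\ a <= l i, l i <= r i, r i <= t & `]l i, r i[ `<=` U],
      forall i j, (i < j < m)%N -> r i <= l j &
      F t - F a <= (k + e) * (t - a) +
        \sum_(i < m) (`|F (r i) - F (l i)| + `|k + e| * (r i - l i))].
have [||m [l [r [hlr ord Fb]]]] := interval_induction (P := P) ab.
- by exists 0%N, (fun=> 0), (fun=> 0); split=> //; rewrite big_ord0; lra.
- move=> t /andP[at_ tb]; have [tU|tU] := pselect (U t).
    move: oU; rewrite openE => /(_ _ tU)/nbhs_ballP[c /= c0 cU].
    exists c => // l1 r1 al1 l1t l1t' r1t r1t' r1b [m [l [r [hlr ord Fl]]]].
    exists m.+1, (fun i => if (i < m)%N then l i else l1),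
      (fun i => if (i < m)%N then r i else r1); split.
    + move=> i _; case: ifP => [/hlr[? ? ? ?]|_]; split=> //; [lra|lra|].
      move=> z /=; rewrite in_itv/= => /andP[? ?]; apply: cU.
      by rewrite -ball_normE/= ltr_norml; lra.
    + move=> i j /andP[ij]; rewrite ltnS leq_eqVlt => /predU1P[jm|jm].
        by move: ij; rewrite jm ltnn => im; rewrite im; case: (hlr i im).
      by rewrite (ltn_trans ij jm) jm; apply: ord; rewrite ij jm.
    + rewrite big_ord_recr/= ltnn.
      under eq_bigr => i _ do rewrite (ltn_ord i).
      have := ler_norm (F r1 - F l1).
      have : - (k + e) * (r1 - l1) <= `|k + e| * (r1 - l1).
        by apply: ler_wpM2r; [lra | rewrite -normrN ler_norm].
      lra.
  have [dF Fk] : derivable F t 1 /\ derive1 F t <= k.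
    apply: contrapT => bad; apply/tU/NU/badN => /= h; apply/bad/h.
    by rewrite at_.
  have [c c0 hc] := derive1_le_incr dF Fk e0.
  exists c => // l1 r1 al1 l1t l1t' r1t r1t' r1b [m [l [r [hlr ord Fl]]]].
  exists m, l, r; split=> //.
    by move=> i /hlr[? ? ? ?]; split=> //; lra.
  have := hc _ _ l1t l1t' r1t r1t'; lra.
apply: (le_trans Fb); rewrite lerD2l.
pose l' (i : 'I_m) := l i; pose r' (i : 'I_m) := r i.
have tI : trivIset [set: 'I_m] (fun i => `]l' i, r' i[%classic).
  move=> i j _ _ [z [/= ]]; rewrite !in_itv/= => /andP[liz zri] /andP[ljz zrj].
  have [ij|ji|/val_inj//] := ltngtP i j.
  - suff : r' i <= l' j.
      by move/(lt_le_trans zri)/lt_trans => /(_ _ ljz); rewrite ltxx.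
    by apply: ord; rewrite ij ltn_ord.
  - suff : r' j <= l' i.
      by move/(lt_le_trans zrj)/lt_trans => /(_ _ liz); rewrite ltxx.
    by apply: ord; rewrite ji ltn_ord.
have hlr' (i : 'I_m) := hlr i (ltn_ord i).
have lt_d : \sum_(i < m) (r' i - l' i) < d.
  rewrite -lte_fin; apply: le_lt_trans Ud.
  by apply: disjoint_intervals_length_le => // i; case: (hlr' i).
have := acd m l' r' (fun i => let: And4 p q s _ := hlr' i in And3 p q s) tI.
move: lt_d; rewrite lt_min => /andP[lt_d' /ltW lt_e] /(_ lt_d')/ltW.
move=> /(ler_wpM2l K0) sumF.
rewrite big_split/= -mulr_sumr /C mulrDl mulrDl -addrA lerD//.
  apply: le_trans sumF; rewrite mulr_sumr; apply: ler_sum => i _.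
  case: (hlr' i) => p q s _; apply: FK; apply/andP; split=> //.
  - exact: le_trans q.
  - exact: le_trans s.
rewrite -mulrDl; apply: ler_pM => //.
  by apply: sumr_ge0 => i _; case: (hlr' i); rewrite subr_ge0.
by rewrite (le_trans (ler_normD _ _))// lerD2l gtr0_norm.
Qed.

End almost_everywhere_derivative.

(** * Gradients along curves and segments *)

Section gradient_calculus.
Variables (R : realType) (n : nat).
Implicit Types (f phi : 'rV[R]_n -> R) (x y : R -> 'rV[R]_n) (u w : 'rV[R]_n).

Lemma is_derive_along f x t : differentiable f (x t) -> derivable x t 1 ->
  is_derive t 1 (f \o x) (dotv (grad f (x t)) (derive1 x t)).
Proof.
move=> df /derivable1_diffP dx.
have dfx : differentiable (f \o x) t by exact: differentiable_comp.
split; first exact/derivable1_diffP.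
by rewrite -derive1E derive1E' // diff_comp// /= -derive1E'// diff_grad.
Qed.

Lemma is_derive_dotv w x t : derivable x t 1 ->
  is_derive t 1 (fun s => dotv w (x s)) (dotv w (derive1 x t)).
Proof.
move=> dx; have q : h^-1 *: (dotv w (x (h *: 1 + t)) - dotv w (x t)) @[h --> 0^'] -->
    dotv w (derive1 x t).
  rewrite (_ : (fun h => _) = (fun h => dotv w (h^-1 *: (x (h + t) - x t)))).
    exact: cvg_dotv (cvg_cst w) (derive1_quotient dx).
  by apply/funext => h; rewrite dotvZr dotvBr [h *: 1]mulr1.
by split; [apply/cvg_ex; eexists; exact: q | exact: cvg_lim q].
Qed.

Lemma is_derive_segment u w (s : R) :
  is_derive s 1 (fun h : R => u + h *: (w - u)) (w - u).
Proof.
have d : is_derive s 1 ( *:%R^~ (w - u) : R -> 'rV[R]_n) (w - u).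
  split; first exact: diff_derivable.
  by rewrite deriveE// diff_val scale1r.
by have := is_deriveD (is_derive_cst u s 1) d; rewrite add0r.
Qed.

Lemma is_derive_on_segment f u w (s : R) : differentiable f (u + s *: (w - u)) ->
  is_derive s 1 (fun h : R => f (u + h *: (w - u)))
    (dotv (grad f (u + s *: (w - u))) (w - u)).
Proof.
move=> df; have [d1 d2] := is_derive_segment u w s.
have := is_derive_along (x := fun h : R => u + h *: (w - u)) df d1.
by rewrite derive1E d2.
Qed.

Lemma gradient_mvt f u w : (forall z, differentiable f z) ->
  exists2 s : R, 0 <= s <= 1 &
    f w - f u = dotv (grad f (u + s *: (w - u))) (w - u).
Proof.
move=> df; have der s := is_derive_on_segment (f := f) (s := s) (df (u + s *: (w - u))).
have [|s] := @MVT_segment R _ _ 0 1 ler01 (fun s _ => der s).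
  by apply: derivable_within_continuous => s _; have [] := der s.
rewrite in_itv/= => s01; rewrite scale1r scale0r addr0 subrKC subr0 mulr1 => ->.
by exists s.
Qed.

Lemma bounded_gradient_lipschitz f G r u w : (forall z, differentiable f z) ->
  (forall z, enorm z <= r -> enorm (grad f z) <= G) ->
  enorm u <= r -> enorm w <= r -> `|f u - f w| <= G * enorm (u - w).
Proof.
move=> df fG.
have half u1 w1 : enorm u1 <= r -> enorm w1 <= r ->
    f w1 - f u1 <= G * enorm (u1 - w1).
  move=> ur wr; have [s /andP[s0 s1] ->] := gradient_mvt u1 w1 df.
  apply: le_trans (cauchy_schwarz _ _) _; rewrite (enormB u1).
  rewrite ler_wpM2r ?enorm_ge0// fG//.
  have -> : u1 + s *: (w1 - u1) = (1 - s) *: u1 + s *: w1.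
    by rewrite scalerBl scale1r scalerBr addrA addrAC.
  apply: le_trans (enormD _ _) _; rewrite !enormZ !ger0_norm ?subr_ge0//.
  have : (1 - s) * enorm u1 <= (1 - s) * r by rewrite ler_wpM2l// subr_ge0.
  have : s * enorm w1 <= s * r by rewrite ler_wpM2l.
  lra.
move=> ur wr; rewrite ler_norml lerNl opprB half//=.
by rewrite enormB half.
Qed.

(** The difference quotients along the segment from [u] to [w] are at most
    phi w - phi u by convexity; comparing with the growth of - phi at 0 (rate at
    most - D + e) turns this into a bound on the directional derivative D. *)
Lemma convex_gradient_le phi u w : convex_function [set: 'rV[R]_n] phi ->
  differentiable phi u -> dotv (grad phi u) (w - u) <= phi w - phi u.
Proof.
move=> cphi dphi; set D := dotv _ _; pose g (h : R) := phi (u + h *: (w - u)).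
have [dg gD] : is_derive (0 : R) 1 g D.
  have := @is_derive_on_segment phi u w 0; rewrite scale0r addr0; exact.
have g0 : g 0 = phi u by rewrite /g scale0r addr0.
have gle (h : R) : 0 <= h -> h <= 1 -> g h - g 0 <= h * (phi w - phi u).
  move=> h0 h1; rewrite g0.
  have h01 : 0 <= h <= 1 by rewrite h0.
  have := cphi (Itv01 h0 h1) w u (in_setT _) (in_setT _).
  rewrite convRE/= [X in phi X](_ : _ = u + h *: (w - u)).
    rewrite /unstable.onem -/(g h); lra.
  rewrite -[LHS]/(h *: w + (1 - h) *: u).
  by rewrite scalerBl scale1r scalerBr addrCA.
apply/ler_addgt0Pr => e e0.
have gN : is_derive (0 : R) 1 (- g) (- D) by exact: is_deriveN.
have [dgN gDN] := gN.
have gN' : derive1 (- g) 0 <= - D by rewrite derive1E gDN.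
have [d d0 hd] := derive1_le_incr dgN gN' e0.
pose h := Num.min 1 (d / 2).
have h0 : 0 < h by rewrite lt_min ltr01 divr_gt0.
have hd2 : h <= d / 2 by rewrite ge_min lexx orbT.
have h1 : h <= 1 by rewrite ge_min lexx.
have := gle h (ltW h0) h1; have := hd 0 h; rewrite !fctE.
rewrite !lexx sub0r oppr_lt0 d0 add0r (ltW h0) subr0 => /(_ isT isT isT).
have hd' : h < d by lra.
move=> /(_ hd') gD' gw; rewrite -(ler_pM2l h0); lra.
Qed.

End gradient_calculus.

(** * Functions with bounded slope away from zero *)

Section bounded_slope.
Variable R : realType.
Implicit Types (H : R -> R) (p m s a b : R).

Lemma derivable_is_derive1 H s : derivable H s 1 -> is_derive s 1 H (derive1 H s).
Proof. by rewrite derive1E; exact: derivableP. Qed.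

(** The common feature of the functions s |-> C s^(1 - theta), ln and the
    identity that makes them composable with an energy gap bounded away from 0:
    they are Lipschitz on every [m, +oo[ with m > 0, whatever happens at 0. *)
Definition bounded_slope H := forall m : R, 0 < m ->
  exists K : R, forall s : R, m <= s -> derivable H s 1 /\ `|derive1 H s| <= K.

Lemma bounded_slope_lipschitz H m : bounded_slope H -> 0 < m ->
  exists2 K : R, 0 <= K &
    forall a b, m <= a -> m <= b -> `|H a - H b| <= K * `|a - b|.
Proof.
move=> HK m0; have [K hK] := HK m m0.
have K0 : 0 <= K by have [_] := hK m (lexx m); exact: le_trans.
exists K => // a b.
wlog ab : a b / a <= b => [wl|] ma mb.
  by have /orP[ab|ba] := le_total a b; last (rewrite distrC (distrC a)); exact: wl.
have d z : m <= z -> is_derive z 1 H (derive1 H z).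
  by move=> /hK[dz _]; exact: derivable_is_derive1.
have [z||z] := MVT_segment ab (f := H) (df := derive1 H).
- by rewrite in_itv/= => /andP[/ltW az _]; apply/d/(le_trans ma).
- apply: derivable_within_continuous => z; rewrite in_itv/= => /andP[az _].
  by have [] := d z (le_trans ma az).
rewrite in_itv/= distrC => /andP[az _] ->.
rewrite normrM (distrC a) ler_wpM2r//.
by have [] := hK z (le_trans ma az).
Qed.

Lemma le_powRN a b p : 0 <= p -> 0 < a -> a <= b ->
  b `^ (- p) <= a `^ (- p).
Proof.
move=> p0 a0 ab; have b0 := lt_le_trans a0 ab.
rewrite !powRN lef_pV2 ?posrE ?powR_gt0//.
by apply: ge0_ler_powR; rewrite ?nnegrE ?(ltW a0) ?(ltW b0).
Qed.

Lemma derive1_powR p s : 0 < s ->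
  derivable (@powR R ^~ p) s 1 /\ derive1 (@powR R ^~ p) s = p * s `^ (p - 1).
Proof. by move=> s0; have [d <-] := is_derive1_powR p s0; rewrite derive1E. Qed.

Lemma bounded_slope_powR p : p < 1 -> bounded_slope (@powR R ^~ p).
Proof.
move=> p1 m m0; exists (`|p| * m `^ (p - 1)) => s ms.
have s0 : 0 < s by exact: lt_le_trans ms.
have [d ->] := derive1_powR p s0; split=> //.
rewrite normrM ler_wpM2l// ger0_norm ?powR_ge0//.
rewrite -(opprB 1) !powRN lef_pV2 ?posrE ?powR_gt0//.
by apply: ge0_ler_powR => //; rewrite ?nnegrE ?subr_ge0 ltW.
Qed.

Lemma bounded_slopeZ C H : bounded_slope H -> bounded_slope (fun s => C * H s).
Proof.
move=> hH m /hH[K hK]; exists (`|C| * K) => s /hK[d dK].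
have [d' e] := is_deriveZ C (derivable_is_derive1 d); rewrite derive1E; split; first exact: d'.
by rewrite e normrM ler_wpM2l.
Qed.

Lemma bounded_slope_id : bounded_slope id.
Proof.
move=> m m0; exists 1 => s _; split; first exact: derivable_id.
by rewrite derive1E derive_id normr1.
Qed.

Lemma bounded_slope_ln : bounded_slope (@ln R).
Proof.
move=> m m0; exists m^-1 => s ms; have s0 : 0 < s by exact: lt_le_trans ms.
have [d e] := is_derive1_ln s0; split=> //.
by rewrite derive1E e ger0_norm ?invr_ge0 ?(ltW s0)// lef_pV2 ?posrE.
Qed.

Lemma derive1_desingularizing C theta s : 0 < s ->
  derive1 (desingularizing C theta) s = C * (1 - theta) * s `^ (- theta).
Proof.
move=> s0; have [d e] := derive1_powR (1 - theta) s0.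
have [_ dC] := is_deriveZ C (derivable_is_derive1 d).
rewrite derive1E [LHS]dC e; rewrite addrAC subrr add0r; exact: mulrA.
Qed.

Lemma bounded_slope_desingularizing C theta : 0 < theta ->
  bounded_slope (desingularizing C theta).
Proof.
by move=> th0; apply/bounded_slopeZ/bounded_slope_powR; rewrite gtrBl.
Qed.

Lemma desingularizing_near0 C theta e : 0 < C -> theta < 1 -> 0 < e ->
  exists2 d : R, 0 < d &
    forall s, 0 < s -> s < d -> desingularizing C theta s < e.
Proof.
move=> C0 th1 e0; exists ((e / C) `^ (1 - theta)^-1).
  by rewrite powR_gt0// divr_gt0.
have p0 : 0 < 1 - theta by rewrite subr_gt0.
move=> s s0 sd; rewrite /desingularizing mulrC -ltr_pdivlMr//.
have -> : e / C = ((e / C) `^ (1 - theta)^-1) `^ (1 - theta).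
  by rewrite -powRrM mulVf ?gt_eqF// powRr1// divr_ge0 ?ltW.
by apply: gt0_ltr_powR => //; rewrite nnegrE ?powR_ge0// ltW.
Qed.

End bounded_slope.

(** * Descent curves *)

Definition descent_at (R : realType) (n : nat) (f : 'rV[R]_n -> R)
    (x : R -> 'rV[R]_n) (lam kap t : R) : Prop :=
  [/\ derivable x t 1,
    dotv (grad f (x t)) (derive1 x t) <= - (lam * enorm (derive1 x t) ^+ 2) &
    enorm (grad f (x t)) <= kap * enorm (derive1 x t)].

(** [G] is a Lipschitz constant of [f] on the range of the curve only: a
    function with Lipschitz gradient is Lipschitz on bounded sets, not globally. *)
Record descent_curve (R : realType) (n : nat) (f : 'rV[R]_n -> R)
    (x : R -> 'rV[R]_n) (lam kap G ell : R) : Prop := DescentCurve {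
  descent_rate_gt0 : 0 < lam;
  descent_error_gt0 : 0 < kap;
  descent_differentiable : forall z, differentiable f z;
  descent_ac : locally_absolutely_continuous x;
  descent_ae : {ae @lebesgue_measure R, forall t : R, 0 <= t ->
    descent_at f x lam kap t};
  descent_lipschitz_ge0 : 0 <= G;
  descent_lipschitz : forall s t : R, 0 <= s -> 0 <= t ->
    `|f (x s) - f (x t)| <= G * enorm (x s - x t);
  descent_lower_bound : forall t : R, 0 <= t -> ell <= f (x t)
}.

Section descent_curve_theory.
Variables (R : realType) (n : nat) (f : 'rV[R]_n -> R) (x : R -> 'rV[R]_n).
Variables (lam kap G ell : R).
Hypothesis dc : descent_curve f x lam kap G ell.
Implicit Types (H : R -> R) (s t c k m e : R).

Let lam0 := descent_rate_gt0 dc.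
Let kap0 := descent_error_gt0 dc.
Let df := descent_differentiable dc.
Let acx := descent_ac dc.
Let desc := descent_ae dc.
Let G0 := descent_lipschitz_ge0 dc.
Let fG := descent_lipschitz dc.
Let ellf := descent_lower_bound dc.

Lemma ac_curve s t : 0 <= s -> 0 <= t -> absolutely_continuous s t x.
Proof.
move=> s0 t0 e e0; have [d d0 hd] := acx (ltr_pwDr ltr01 t0) e0.
exists d => // m l r lr; apply: hd => i; have [sl lri rt] := lr i.
by split; [exact: le_trans sl | by [] | exact/(le_trans rt)/ltW/ltr_pwDr].
Qed.

Lemma curve_uniformly_continuous s t e : 0 <= s -> 0 <= t -> 0 < e ->
  exists2 d : R, 0 < d & forall a b, s <= a -> a <= b -> b <= t -> b - a < d ->
    enorm (x b - x a) < e.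
Proof.
move=> s0 t0 e0; have [d d0 hd] := ac_curve s0 t0 e0; exists d => // a b sa ab bt bad.
have := hd 1%N (fun=> a) (fun=> b); rewrite !big_ord1; apply=> //.
by move=> i j _ _ _; rewrite !ord1.
Qed.

(** The master inequality. The linear term measures displacement in a fixed
    direction; [H], evaluated at the energy above the level [c], is the
    Lyapunov function. The margin [m] keeps the energy gap where [H] is
    Lipschitz. Taking the pointwise bound as hypothesis lets each use combine
    the decrease and the relative error in its own way. *)
Lemma energy_comparison H w c m s t k : bounded_slope H -> 0 < m ->
  0 <= s -> s <= t -> (forall a, s <= a <= t -> m <= f (x a) - c) ->
  (forall a, s <= a <= t -> descent_at f x lam kap a ->
    dotv w (derive1 x a) +
      derive1 H (f (x a) - c) * dotv (grad f (x a)) (derive1 x a) <= k) ->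
  dotv w (x t - x s) + (H (f (x t) - c) - H (f (x s) - c)) <= k * (t - s).
Proof.
move=> hH m0 s0 st mE hk; have t0 := le_trans s0 st.
have [K K0 HK] := bounded_slope_lipschitz hH m0.
pose F a := dotv w (x a) + H (f (x a) - c).
have C0 : 0 <= enorm w + K * G by rewrite addr_ge0 ?enorm_ge0 ?mulr_ge0.
have FC a b : s <= a <= t -> s <= b <= t ->
    `|F a - F b| <= (enorm w + K * G) * enorm (x a - x b).
  move=> ast bst; have a0 : 0 <= a by case/andP: ast => /(le_trans s0).
  have b0 : 0 <= b by case/andP: bst => /(le_trans s0).
  rewrite /F opprD addrACA -dotvBr (le_trans (ler_normD _ _))// mulrDl lerD//.
    exact: normr_dotv_le.
  apply: le_trans (HK _ _ (mE _ ast) (mE _ bst)) _.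
  rewrite opprB addrA subrK -mulrA ler_wpM2l//; exact: fG.
have Fk : {ae @lebesgue_measure R, forall a, s <= a <= t ->
    derivable F a 1 /\ derive1 F a <= k}.
  have [N [mN N0 sub]] := desc; exists N; split=> //.
  apply: subset_trans sub; apply: subsetC => a hd ast.
  have a0 : 0 <= a by case/andP: ast => /(le_trans s0).
  have dat := hd a0; have [dx _ _] := dat; have := hk a ast dat.
  have [K' hK'] := hH m m0; have [dH _] := hK' _ (mE _ ast).
  have d1 := is_derive_dotv w dx.
  have [d2 d2E] := is_derive_along (df (x a)) dx.
  have d2' : is_derive a 1 (fun b => f (x b) - c) (dotv (grad f (x a)) (derive1 x a)).
    have := is_deriveD (f := f \o x) (DeriveDef d2 d2E) (is_derive_cst (- c) a 1).
    by rewrite addr0.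
  have d4 := is_derive1_comp
    (g := fun b => f (x b) - c) (derivable_is_derive1 dH) d2'.
  have [d5 d5E] := is_deriveD d1 d4.
  move=> h; split; first exact: d5.
  by apply: le_trans h; rewrite derive1E le_eqVlt; apply/orP; left; apply/eqP/d5E.
have := ae_derive1_le_incr st C0 (ac_curve s0 t0) FC Fk.
by rewrite /F dotvBr; lra.
Qed.

(** The level ell - 1 keeps the energy gap at least 1 without any knowledge of
    monotonicity, which is itself the case g = 0 of this estimate. *)
Lemma energy_gap g s t : 0 <= s -> s <= t -> 0 <= g ->
  (forall a, s <= a <= t -> g <= enorm (grad f (x a))) ->
  lam * (g / kap) ^+ 2 * (t - s) <= f (x s) - f (x t).
Proof.
move=> s0 st g0 gf.
have := @energy_comparison id 0 (ell - 1) 1 s t (- (lam * (g / kap) ^+ 2))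
  (@bounded_slope_id R) ltr01 s0 st.
rewrite dotv0l.
have pre a : s <= a <= t -> 1 <= f (x a) - (ell - 1).
  by move=> /andP[/(le_trans s0)/ellf]; lra.
move=> /(_ pre) h; suff : f (x t) - (ell - 1) - (f (x s) - (ell - 1)) <=
  - (lam * (g / kap) ^+ 2) * (t - s) by lra.
move: h; rewrite add0r; apply => a ast [_ da ka].
rewrite dotv0l add0r derive1E derive_id mul1r.
apply: le_trans da _; rewrite lerN2 ler_wpM2l ?(ltW lam0)//.
rewrite ler_pXn2r ?nnegrE ?enorm_ge0 ?divr_ge0 ?(ltW kap0)//.
by rewrite ler_pdivrMr// mulrC (le_trans (gf a ast)).
Qed.

Lemma energy_nonincreasing s t : 0 <= s -> s <= t -> f (x t) <= f (x s).
Proof.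
move=> s0 st; have := energy_gap s0 st (lexx 0) (fun a _ => enorm_ge0 _).
by rewrite mul0r expr0n /= mulr0 mul0r subr_ge0.
Qed.

(** Chain rule: - (H (e))' >= lam H'(e) |x'|^2 >= lam / kap^2 * H'(e) |grad f|^2. *)
Lemma desingularized_gap H c k s t : bounded_slope H -> 0 <= s -> s <= t ->
  c < f (x t) -> 0 <= k ->
  (forall a, s <= a <= t -> 0 <= derive1 H (f (x a) - c) /\
     k <= derive1 H (f (x a) - c) * enorm (grad f (x a)) ^+ 2) ->
  lam / kap ^+ 2 * k * (t - s) <= H (f (x s) - c) - H (f (x t) - c).
Proof.
move=> hH s0 st ct k0 hk.
have ctp : 0 < f (x t) - c by rewrite subr_gt0.
have := @energy_comparison H 0 c (f (x t) - c) s t (- (lam / kap ^+ 2 * k))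
  hH ctp s0 st.
rewrite dotv0l add0r => h.
rewrite -lerN2 opprB -mulNr; apply: h => a /[dup] ast /andP[sa at_].
  by rewrite lerD2r energy_nonincreasing// (le_trans s0).
move=> [_ da ka]; have [H0 kH] := hk a ast.
rewrite dotv0l add0r.
apply: le_trans (ler_wpM2l H0 da) _; rewrite mulrN lerN2.
set h' := derive1 H _ in H0 kH *; set z := enorm (derive1 x a) in ka *.
rewrite (_ : h' * _ = lam / kap ^+ 2 * (h' * (kap * z) ^+ 2)); last first.
  by field; rewrite gt_eqF.
rewrite ler_wpM2l ?divr_ge0 ?sqr_ge0 ?(ltW lam0)//.
apply: le_trans kH _; rewrite ler_wpM2l// ler_pXn2r ?nnegrE ?enorm_ge0//.
by rewrite mulr_ge0 ?enorm_ge0 ?(ltW kap0).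
Qed.

(** If H'(e) |grad f| >= 1 then H'(e) kap |x'| >= 1, so that
    - (H (e))' >= lam H'(e) |x'|^2 >= lam / kap * |x'|: the decrease of H (e)
    pays for the length of the curve. *)
Lemma desingularized_length H c s t : bounded_slope H -> 0 <= s -> s <= t ->
  c < f (x t) ->
  (forall a, s <= a <= t ->
     1 <= derive1 H (f (x a) - c) * enorm (grad f (x a))) ->
  lam / kap * enorm (x t - x s) <= H (f (x s) - c) - H (f (x t) - c).
Proof.
move=> hH s0 st ct hk; set d := x t - x s.
have ctp : 0 < f (x t) - c by rewrite subr_gt0.
(* w points along the displacement d and has length lam / kap, or is 0 when
   d = 0; in both cases <w, d> = lam / kap * |d|, as 0^-1 = 0. *)
pose w := (lam / kap * (enorm d)^-1) *: d.
have wle : enorm w <= lam / kap.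
  rewrite enormZ ger0_norm ?mulr_ge0 ?invr_ge0 ?enorm_ge0 ?(ltW lam0) ?(ltW kap0)//.
  have [->|d0] := eqVneq (enorm d) 0; last by rewrite divfK.
  by rewrite mulr0 divr_ge0 ?(ltW lam0) ?(ltW kap0).
have wd : dotv w d = lam / kap * enorm d.
  rewrite dotvZl -sqr_enorm -mulrA; congr (_ * _).
  have [->|d0] := eqVneq (enorm d) 0; first by rewrite expr0n mulr0.
  by rewrite expr2 mulKf.
have := @energy_comparison H w c (f (x t) - c) s t 0 hH ctp s0 st.
rewrite mul0r -/d wd => h.
suff : lam / kap * enorm d + (H (f (x t) - c) - H (f (x s) - c)) <= 0 by lra.
apply: h => a /[dup] ast /andP[sa at_].
  by rewrite lerD2r energy_nonincreasing// (le_trans s0).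
move=> [_ da ka]; have Hk := hk a ast; set h := derive1 H _ in Hk *.
have h0 : 0 <= h.
  have := enorm_ge0 (grad f (x a)); rewrite leNgt; move: Hk => /[swap]; nra.
set z := derive1 x a in da ka *.
have z0 : 0 <= enorm z by exact: enorm_ge0.
have hz : 1 <= h * (kap * enorm z) by rewrite (le_trans Hk)// ler_wpM2l.
have dw : dotv w z <= lam / kap * enorm z.
  by rewrite (le_trans (cauchy_schwarz _ _))// ler_wpM2r.
have : lam / kap * enorm z <= lam * h * enorm z ^+ 2.
  have -> : lam * h * enorm z ^+ 2 = lam / kap * enorm z * (h * (kap * enorm z)).
    by field; rewrite gt_eqF.
  by rewrite ler_peMr// mulr_ge0// divr_ge0 ?ltW.
have := ler_wpM2l h0 da; lra.
Qed.

(** With H = A * id and w the displacement d, the pointwise bound is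
    |d| |x'| - A lam |x'|^2 <= |d|^2 / (4 A lam). As the energy does not change,
    |d|^2 <= |d|^2 (t - s) / (4 A lam), and A is chosen so large that this
    forces d = 0. *)
Lemma stationary s t : 0 <= s -> s <= t -> f (x t) = f (x s) -> x t = x s.
Proof.
move=> s0 st fts; set d := x t - x s.
pose A := (2 * (t - s) + 1) / (4 * lam).
have ts : 0 <= t - s by rewrite subr_ge0.
have A0 : 0 < A by rewrite divr_gt0 ?mulr_gt0// ltr_wpDl// mulr_ge0.
have := @energy_comparison (fun e => A * e) d (ell - 1) 1 s t
  (enorm d ^+ 2 / (2 * (t - s) + 1))
  (bounded_slopeZ A (@bounded_slope_id R)) ltr01 s0 st.
rewrite fts subrr addr0 -sqr_enorm => h.
have {}h : enorm d ^+ 2 <= enorm d ^+ 2 / (2 * (t - s) + 1) * (t - s).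
  apply: h => a /[dup] ast /andP[sa at_].
    by have := ellf (le_trans s0 sa); lra.
  move=> [_ da _]; have -> : derive1 (fun e => A * e) (f (x a) - (ell - 1)) = A.
    rewrite derive1E; have [_] := is_deriveZ A (is_derive_id (f (x a) - (ell - 1)) 1).
    by move=> ->; rewrite [LHS]mulr1.
  have := ler_wpM2l (ltW A0) da; have := cauchy_schwarz d (derive1 x a).
  set z := enorm (derive1 x a); set u := enorm d.
  have : u * z - A * lam * z ^+ 2 <= u ^+ 2 / (2 * (t - s) + 1).
    have c0 : 0 < 2 * (t - s) + 1 by lra.
    rewrite ler_pdivlMr//.
    have -> : A * lam = (2 * (t - s) + 1) / 4 by rewrite /A; field; rewrite gt_eqF.
    have := sqr_ge0 (u - (2 * (t - s) + 1) / 2 * z).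
    by set c := 2 * (t - s) + 1; nra.
  lra.
apply/eqP; rewrite -subr_eq0 -/d; apply/eqP/enorm0_eq0/eqP.
rewrite -sqrf_eq0 eq_le sqr_ge0 andbT.
move: h; have c0 : 0 < 2 * (t - s) + 1 by lra.
rewrite mulrAC ler_pdivlMr//; nra.
Qed.

End descent_curve_theory.

(** * Convergence under a KL inequality *)

Section convergence.
Variables (R : realType) (n : nat) (f : 'rV[R]_n -> R) (x : R -> 'rV[R]_n).
Variables (lam kap G ell : R) (xbar : 'rV[R]_n).
Hypothesis dc : descent_curve f x lam kap G ell.
Hypothesis xbar_cluster : forall T e : R, 0 < e ->
  exists2 t : R, T <= t & enorm (x t - xbar) < e.
Implicit Types (H : R -> R) (s t T e r eta : R) (u : 'rV[R]_n).

Let lam0 := descent_rate_gt0 dc.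
Let kap0 := descent_error_gt0 dc.
Let df := descent_differentiable dc.

Let lk0 : 0 < lam / kap. Proof. exact: divr_gt0. Qed.

Lemma near_limit_point T e r : 0 < e -> 0 < r ->
  exists t, [/\ T <= t, enorm (x t - xbar) < r & `|f (x t) - f xbar| < e].
Proof.
move=> e0 r0; have /cvgrPdist_lt/(_ e e0)/nbhs_enorm_lt[d d0 hd] :
  f @ xbar --> f xbar by exact: differentiable_continuous (df xbar).
have [|t Tt] := @xbar_cluster T (Num.min d r); first by rewrite lt_min d0.
by rewrite lt_min => /andP[/hd td tr]; exists t; rewrite distrC.
Qed.

Lemma limit_value_le t : 0 <= t -> f xbar <= f (x t).
Proof.
move=> t0; rewrite leNgt; apply/negP => lt_f.
have [|s [ts _ sf]] := @near_limit_point t (f xbar - f (x t)) 1 _ ltr01.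
  by rewrite subr_gt0.
have := energy_nonincreasing dc t0 ts; move: sf; rewrite ltr_norml; lra.
Qed.

Lemma finite_time T : 0 <= T -> f (x T) = f xbar ->
  forall t, T <= t -> x t = xbar.
Proof.
move=> T0 fT; have cst t : T <= t -> x t = x T.
  move=> Tt; apply: (stationary dc T0 Tt).
  have := limit_value_le (le_trans T0 Tt).
  by have := energy_nonincreasing dc T0 Tt; lra.
move=> t /cst->; apply/eqP; rewrite -subr_eq0; apply/eqP/enorm0_eq0/eqP.
rewrite eq_le enorm_ge0 andbT; apply/ler_addgt0Pl => e e0; rewrite addr0.
by have [s /cst-> /ltW] := @xbar_cluster T e e0.
Qed.

(** Start at a time [T] when both |x T - xbar| and the length that [H] still
    allows are below r / 2. As long as the curve has stayed in the ball, its
    distance to xbar is at most their sum q < r; uniform continuity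
    leaves room r - q for a further step of a fixed size. *)
Lemma trapped H r eta : bounded_slope H -> 0 < r -> 0 < eta ->
  (forall s, 0 < s -> 0 <= H s) ->
  (forall e, 0 < e -> exists2 d : R, 0 < d & forall s, 0 < s -> s < d -> H s < e) ->
  (forall t, 0 <= t -> f xbar < f (x t)) ->
  (forall u, enorm (u - xbar) < r -> f xbar < f u -> f u < f xbar + eta ->
     1 <= derive1 H (f u - f xbar) * enorm (grad f u)) ->
  exists2 T, 0 <= T & forall t, T <= t -> enorm (x t - xbar) < r.
Proof.
move=> hH r0 eta0 H0 Hnear above KL.
have r2 : 0 < r / 2 by rewrite divr_gt0.
have [d d0 hd] := Hnear _ (mulr_gt0 lk0 r2).
have [|T [T0 Tr Tf]] := @near_limit_point 0 (Num.min eta d) (r / 2) _ r2.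
  by rewrite lt_min eta0.
have fT := above T T0.
rewrite ger0_norm ?subr_ge0 ?(ltW fT)// lt_min in Tf.
case/andP: Tf => Teta Td.
have {hd}HT : H (f (x T) - f xbar) < lam / kap * (r / 2) by rewrite hd// subr_gt0.
exists T => // t Tt.
set q := enorm (x T - xbar) + (lam / kap)^-1 * H (f (x T) - f xbar).
have qr : q < r.
  have : (lam / kap)^-1 * H (f (x T) - f xbar) < r / 2 by rewrite ltr_pdivrMl.
  by rewrite /q; lra.
have rq : 0 < r - q by rewrite subr_gt0.
have [c c0 hc] := curve_uniformly_continuous dc T0 (le_trans T0 Tt) rq.
pose P b := forall a, T <= a <= b -> enorm (x a - xbar) < r.
suff : P t by apply; rewrite Tt lexx.
apply: (interval_induction Tt) => [a|z /andP[Tz zt]].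
  by rewrite -eq_le => /eqP <-; lra.
exists (c / 2) => [|l b Tl lz lz' zb bz bt Pl a /andP[Ta ab]].
  by rewrite divr_gt0.
have [al|la] := leP a l; first by apply: Pl; rewrite Ta.
have len : enorm (x l - x T) <= (lam / kap)^-1 * H (f (x T) - f xbar).
  have fl := above l (le_trans T0 Tl).
  rewrite ler_pdivlMl//.
  apply: le_trans (desingularized_length dc hH T0 Tl fl _) _ => [w Twl|].
    have w0 : 0 <= w by case/andP: Twl => /(le_trans T0).
    apply: KL; [exact: Pl | exact: above |].
    case/andP: Twl => Tw wl; have := energy_nonincreasing dc T0 Tw; lra.
  by rewrite gerBl H0// subr_gt0.
have close : enorm (x a - x l) < r - q.
  apply: hc => //; [exact: ltW | exact: le_trans bt | lra].
have -> : x a - xbar = (x a - x l) + ((x l - x T) + (x T - xbar)).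
  by rewrite addrA subrKA subrKA.
apply: le_lt_trans (enormD _ _) _.
by have := enormD (x l - x T) (x T - xbar); rewrite /q in close; lra.
Qed.

(** The tail length bounds |x s - x t| for every s >= t; s is taken at a time
    when x s is close to xbar. *)
Lemma distance_to_limit H T t : bounded_slope H -> 0 <= T -> T <= t ->
  (forall s, 0 < s -> 0 <= H s) ->
  (forall s, 0 <= s -> f xbar < f (x s)) ->
  (forall s, T <= s ->
    1 <= derive1 H (f (x s) - f xbar) * enorm (grad f (x s))) ->
  enorm (x t - xbar) <= kap / lam * H (f (x t) - f xbar).
Proof.
move=> hH T0 Tt H0 above KL; have t0 := le_trans T0 Tt.
apply/ler_addgt0Pr => e e0; have [s ts se] := @xbar_cluster t e e0.
have fs := above s (le_trans t0 ts).
have len : lam / kap * enorm (x s - x t) <=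
    H (f (x t) - f xbar) - H (f (x s) - f xbar).
  by apply: (desingularized_length dc) => // a /andP[ta _]; exact/KL/(le_trans Tt).
have {}len : enorm (x s - x t) <= kap / lam * H (f (x t) - f xbar).
  rewrite -[kap / lam]invf_div ler_pdivlMl//; apply: le_trans len _.
  by rewrite gerBl H0// subr_gt0.
have -> : x t - xbar = - (x s - x t) + (x s - xbar) by rewrite opprB addrA subrK.
apply: le_trans (enormD _ _) _; rewrite enormN; lra.
Qed.

(** If the gradient did not vanish at xbar, its norm would stay bounded below
    along the curve and the energy would decrease at a constant rate forever. *)
Lemma gradient_limit0 : continuous (grad f) ->
  (forall e, 0 < e -> exists2 T, 0 <= T & forall t, T <= t -> enorm (x t - xbar) < e) ->
  grad f xbar = 0.
Proof.
move=> cg cvx; apply: enorm0_eq0; apply/eqP; rewrite eq_le enorm_ge0 andbT leNgt.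
apply/negP; set g := enorm _ => g0.
have g20 : 0 < g / 2 by rewrite divr_gt0.
have cvg_g : enorm (grad f u) @[u --> xbar] --> g by exact: cvg_enorm (cg xbar).
have /cvgrPdist_lt/(_ _ g20)/nbhs_enorm_lt[d d0 hd] := cvg_g.
have [T T0 hT] := cvx d d0.
have far t : T <= t -> g / 2 <= enorm (grad f (x t)).
  by move=> /hT/hd; rewrite -/g ltr_norml; lra.
set k := lam * (g / 2 / kap) ^+ 2.
have k0 : 0 < k by rewrite mulr_gt0// exprn_gt0// divr_gt0.
pose t := T + (f (x T) - f xbar + 1) / k.
have fT := limit_value_le T0.
have Tt : T <= t by rewrite lerDl divr_ge0 ?(ltW k0)//; lra.
have := energy_gap dc T0 Tt (ltW g20) (fun a h => far a (andP h).1).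
rewrite -/k /t addrC addKr mulrC divfK ?gt_eqF//.
have := limit_value_le (le_trans T0 Tt); rewrite /t; lra.
Qed.

(** Shrinking the KL neighbourhood to the ball of radius [e] before trapping
    turns trapping into convergence. *)
Lemma kl_convergence : KL_power_at f xbar ->
  forall e, 0 < e -> exists2 T, 0 <= T & forall t, T <= t -> enorm (x t - xbar) < e.
Proof.
move=> [eta [U [C [theta [eta0 Uxbar C0 /andP[th0 th1] KL]]]]] e e0.
have [[T T0 fT]|above] := pselect (exists2 T, 0 <= T & f (x T) = f xbar).
  exists T => // t Tt; rewrite (finite_time T0 fT Tt) subrr enorm0//.
have {}above t : 0 <= t -> f xbar < f (x t).
  move=> t0; rewrite lt_def limit_value_le// andbT; apply/eqP => ft.
  by apply: above; exists t.
have [r r0 rU] := nbhs_enorm_lt Uxbar.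
have [eta' [eta'0 eta'le]] : exists eta' : R, 0 < eta' /\ (eta'%:E <= eta)%E.
  case: eta eta0 {KL} => [z|_|//]; last by exists 1; rewrite leey.
  by rewrite lte_fin => z0; exists z.
have m0 : 0 < Num.min e r by rewrite lt_min e0.
have [|||T T0 hT] := @trapped (desingularizing C theta) (Num.min e r) eta'
  (bounded_slope_desingularizing _ th0) m0 eta'0 _ _ above.
- by move=> s s0; rewrite mulr_ge0 ?powR_ge0// ltW.
- by move=> e' e'0; exact: desingularizing_near0.
- move=> u; rewrite lt_min => /andP[_ ur] fu fu'; apply: KL => //; first exact: rU.
  apply: (@lt_le_trans _ _ ((f xbar)%:E + eta'%:E)%E).
    by rewrite -EFinD lte_fin.
  by rewrite leeD2l.
by exists T => // t /hT; rewrite lt_min => /andP[].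
Qed.

End convergence.

(** * Rates of convergence from a Lojasiewicz inequality *)

Section rates.
Variables (R : realType) (n : nat) (f : 'rV[R]_n -> R) (x : R -> 'rV[R]_n).
Variables (lam kap G ell : R) (xbar : 'rV[R]_n).
Hypothesis dc : descent_curve f x lam kap G ell.
Hypothesis x_cvg : forall e : R, 0 < e ->
  exists2 T : R, 0 <= T & forall t : R, T <= t -> enorm (x t - xbar) < e.
Variables (C eps theta : R).
Hypotheses (th01 : 0 < theta < 1) (C0 : 0 < C) (eps0 : 0 < eps).
Hypothesis loj : forall u, enorm (u - xbar) < eps ->
  `|f u - f xbar| `^ theta <= C * enorm (grad f u).

Let lam0 := descent_rate_gt0 dc.
Let kap0 := descent_error_gt0 dc.

Let xbar_cluster (T e : R) : 0 < e -> exists2 t, T <= t & enorm (x t - xbar) < e.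
Proof.
move=> e0; have [S S0 hS] := x_cvg e0; exists (Num.max S T).
  by rewrite le_max lexx orbT.
by apply: hS; rewrite le_max lexx.
Qed.

Section infinite_time.
Variable T : R.
Hypothesis T0 : 0 <= T.
Hypothesis above : forall t : R, 0 <= t -> f xbar < f (x t).
Hypothesis near_xbar : forall t : R, T <= t -> enorm (x t - xbar) < eps.

Local Notation gap t := (f (x t) - f xbar).

Let gap_gt0 t : T <= t -> 0 < gap t.
Proof. by move=> Tt; rewrite subr_gt0 above// (le_trans T0). Qed.

Let loj_along t : T <= t -> gap t `^ theta <= C * enorm (grad f (x t)).
Proof.
by move=> Tt; have := loj (near_xbar Tt); rewrite ger0_norm// ltW// gap_gt0.
Qed.

(** The Lojasiewicz inequality is the KL inequality for the desingularizing
    function whose derivative is C s^(- theta). *)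
Lemma distance_le_gap t : T <= t ->
  enorm (x t - xbar) <= kap / lam * (C / (1 - theta) * gap t `^ (1 - theta)).
Proof.
have [th0 th1] := andP th01; have th1' : 0 < 1 - theta by rewrite subr_gt0.
move=> Tt; apply: (distance_to_limit (H := desingularizing (C / (1 - theta)) theta)
  dc xbar_cluster _ T0 Tt) => //.
- exact: bounded_slope_desingularizing.
- by move=> s s0; rewrite mulr_ge0 ?powR_ge0// divr_ge0 ?ltW.
move=> s Ts; have g0 := gap_gt0 Ts.
rewrite derive1_desingularizing// divfK ?gt_eqF// powRN mulrAC.
by rewrite ler_pdivlMr ?powR_gt0// mul1r; exact: loj_along.
Qed.

Lemma gradient_sqr_ge t : T <= t ->
  C ^- 2 <= gap t `^ (- (2 * theta)) * enorm (grad f (x t)) ^+ 2.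
Proof.
move=> Tt; have g0 := gap_gt0 Tt.
rewrite powRN ler_pdivlMl ?powR_gt0// mulrC ler_pdivrMl ?exprn_gt0//.
rewrite -exprMn mulrC powRrM powR_mulrn ?powR_ge0//.
rewrite ler_pXn2r ?nnegrE ?powR_ge0 ?loj_along//.
by rewrite mulr_ge0 ?enorm_ge0// ltW.
Qed.

(** H (s) = s^(1 - 2 theta) / (1 - 2 theta), with H'(s) = s^(- 2 theta), is the
    function that linearizes the differential inequality - e' >= k e^(2 theta);
    it covers theta on both sides of 1/2. *)
Lemma gap_power_decay t : theta != 2^-1 -> T <= t ->
  lam / kap ^+ 2 * C ^- 2 * (t - T) <=
    (1 - 2 * theta)^-1 * (gap T `^ (1 - 2 * theta) - gap t `^ (1 - 2 * theta)).
Proof.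
move=> th2 Tt; have [th0 th1] := andP th01.
have q0 : 1 - 2 * theta != 0.
  by apply: contraNneq th2 => q; apply/eqP; lra.
rewrite [leRHS]mulrBr.
apply: (desingularized_gap (H := desingularizing (1 - 2 * theta)^-1 (2 * theta)) dc) => //.
- by apply: bounded_slope_desingularizing; rewrite mulr_gt0.
- by rewrite above// (le_trans T0).
- by rewrite invr_ge0 exprn_ge0// ltW.
move=> a /andP[Ta _]; have g0 := gap_gt0 Ta.
rewrite derive1_desingularizing// mulVf// mul1r; split; first exact: powR_ge0.
exact: gradient_sqr_ge.
Qed.

Lemma gap_ln_decay t : theta = 2^-1 -> T <= t ->
  lam / kap ^+ 2 * C ^- 2 * (t - T) <= ln (gap T) - ln (gap t).
Proof.
move=> th2 Tt; apply: (desingularized_gap dc) => //.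
- exact: bounded_slope_ln.
- by rewrite above// (le_trans T0).
- by rewrite invr_ge0 exprn_ge0// ltW.
move=> a /andP[Ta _]; have g0 := gap_gt0 Ta.
have [_ e] := is_derive1_ln g0; rewrite derive1E e.
split; first by rewrite invr_ge0 ltW.
have := gradient_sqr_ge Ta; rewrite th2 divff// powR_inv1//.
exact: ltW.
Qed.

(** For theta < 1/2 the quantity e^(1 - 2 theta) / (1 - 2 theta) is nonnegative
    and decreases at least linearly, which cannot go on forever. *)
Lemma infinite_time_exponent : 2^-1 <= theta.
Proof.
rewrite leNgt; apply/negP => th2; have q0 : 0 < 1 - 2 * theta by lra.
set k := lam / kap ^+ 2 * C ^- 2.
have k0 : 0 < k by rewrite mulr_gt0 ?divr_gt0 ?invr_gt0 ?exprn_gt0.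
set M := (1 - 2 * theta)^-1 * gap T `^ (1 - 2 * theta).
have M0 : 0 <= M by rewrite mulr_ge0 ?powR_ge0// invr_ge0 ltW.
have Tt : T <= T + (M + 1) / k by rewrite lerDl divr_ge0 ?(ltW k0)//; lra.
have := gap_power_decay (negbT (lt_eqF th2)) Tt.
rewrite -/k addrC addKr mulrC divfK ?gt_eqF// [leRHS]mulrBr -/M.
have : 0 <= (1 - 2 * theta)^-1 * gap (T + (M + 1) / k) `^ (1 - 2 * theta).
  by rewrite mulr_ge0 ?powR_ge0// invr_ge0 ltW.
rewrite (addrC T); lra.
Qed.

Lemma exponential_rate : theta = 2^-1 -> exists B b : R, [/\ 0 < B, 0 < b &
  forall t, T <= t -> enorm (x t - xbar) <= B * expR (- (b * t))].
Proof.
move=> th2; set k := lam / kap ^+ 2 * C ^- 2.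
have k0 : 0 < k by rewrite mulr_gt0 ?divr_gt0 ?invr_gt0 ?exprn_gt0.
set D := kap / lam * (C / (1 - theta)).
have D0 : 0 < D by case/andP: th01 => ? ?; rewrite mulr_gt0 ?divr_gt0 ?subr_gt0.
exists (D * expR (2^-1 * (ln (gap T) + k * T))), (k / 2); split.
- by rewrite mulr_gt0 ?expR_gt0.
- by rewrite divr_gt0.
move=> t Tt; apply: le_trans (distance_le_gap Tt) _.
rewrite mulrA -/D -mulrA ler_wpM2l ?(ltW D0)//.
rewrite /powR gt_eqF ?gap_gt0// -expRD ler_expR th2.
have := gap_ln_decay th2 Tt; rewrite -/k; lra.
Qed.

(** Here [gap_power_decay] reads e t ^ (1 - 2 theta) >= (2 theta - 1) k (t - T) + m
    with m = e T ^ (1 - 2 theta). From time 2 T on, t - T >= t / 2, and the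
    right-hand side dominates b t + b for one small constant b. *)
Lemma power_rate : 2^-1 < theta -> exists B b : R, [/\ 0 < B, 0 < b &
  forall t, 2 * T <= t ->
    enorm (x t - xbar) <= B * (b * t + b) `^ (- ((1 - theta) / (2 * theta - 1)))].
Proof.
move=> th2; have [th0 th1] := andP th01.
set k := lam / kap ^+ 2 * C ^- 2.
have k0 : 0 < k by rewrite mulr_gt0 ?divr_gt0 ?invr_gt0 ?exprn_gt0.
set D := kap / lam * (C / (1 - theta)).
have D0 : 0 < D by rewrite mulr_gt0 ?divr_gt0 ?subr_gt0.
have q0 : 0 < 2 * theta - 1 by lra.
set p := (1 - theta) / (2 * theta - 1).
have p0 : 0 <= p by rewrite divr_ge0 ?(ltW q0)//; lra.
set m := gap T `^ (1 - 2 * theta).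
have m0 : 0 < m by rewrite powR_gt0// gap_gt0.
set b := Num.min ((2 * theta - 1) * k / 2) m.
have b0 : 0 < b by rewrite lt_min m0 andbT divr_gt0// mulr_gt0.
exists D, b; split=> // t T2t; have Tt : T <= t by have := T0; lra.
have t0 := le_trans T0 Tt.
apply: le_trans (distance_le_gap Tt) _.
rewrite mulrA -/D ler_wpM2l ?(ltW D0)//.
have -> : 1 - theta = (1 - 2 * theta) * (- p).
  by rewrite /p; field; rewrite gt_eqF.
rewrite powRrM; apply: le_powRN => //.
  by rewrite ltr_wpDl// mulr_ge0// ltW.
have := gap_power_decay (negbT (gt_eqF th2)) Tt; rewrite -/k -/m.
rewrite -(opprB (2 * theta) 1) invrN mulNr -mulrN opprB ler_pdivlMl//.
have : b * t <= (2 * theta - 1) * k / 2 * t by rewrite ler_wpM2r// ge_min lexx.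
have : b <= m by rewrite ge_min lexx orbT.
have : (2 * theta - 1) * k * (2 * T) <= (2 * theta - 1) * k * t.
  by rewrite ler_wpM2l// mulr_ge0 ?ltW.
lra.
Qed.

End infinite_time.

Lemma lojasiewicz_rates : exists B b T : R, [/\ 0 < B, 0 < b, 0 <= T,
    theta < 2^-1 -> converges_in_finite_time x xbar &
    forall t, T <= t ->
      (theta = 2^-1 -> enorm (x t - xbar) <= B * expR (- (b * t))) /\
      (2^-1 < theta -> enorm (x t - xbar) <=
         B * (b * t + b) `^ (- ((1 - theta) / (2 * theta - 1))))].
Proof.
have [[T T0 fT]|above] := pselect (exists2 T, 0 <= T & f (x T) = f xbar).
  have xT := finite_time dc xbar_cluster T0 fT.
  exists 1, 1, T; split=> // [_|t /xT->]; first by exists T.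
  by rewrite subrr enorm0 !mul1r powR_ge0 expR_ge0.
have {}above t : 0 <= t -> f xbar < f (x t).
  move=> t0; rewrite lt_def (limit_value_le dc xbar_cluster)// andbT.
  by apply/eqP => ft; apply: above; exists t.
have [T T0 hT] := x_cvg eps0.
have := infinite_time_exponent T0 above hT; rewrite le_eqVlt => /predU1P[th2|th2].
  have [B [b [B0 b0 hB]]] := exponential_rate T0 above hT (esym th2).
  exists B, b, T; split=> // [|t /hB]; first by rewrite th2 ltxx.
  by rewrite th2 ltxx.
have [B [b [B0 b0 hB]]] := power_rate T0 above hT th2.
exists B, b, (2 * T); split=> //; first by rewrite mulr_ge0.
  by move=> /(lt_trans th2); rewrite ltxx.
by move=> t /hB hBt; split=> // th; move: th2; rewrite th ltxx.
Qed.

End rates.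

(** * Solutions of the dynamical system *)

Section dynamical_system.
Variables (R : realType) (n : nat).
Implicit Types (phi psi f : 'rV[R]_n -> R) (x v : R -> 'rV[R]_n) (u w : 'rV[R]_n).

Lemma gradD phi psi u : differentiable phi u -> differentiable psi u ->
  grad (phi \+ psi) u = grad phi u + grad psi u.
Proof.
move=> dphi dpsi; apply/rowP => i; rewrite !mxE.
by rewrite (@deriveD _ _ _ phi psi)//; exact: diff_derivable.
Qed.

Lemma elipschitzD k1 k2 (g1 g2 : 'rV[R]_n -> 'rV[R]_n) :
  elipschitz k1 g1 -> elipschitz k2 g2 ->
  elipschitz (k1 + k2) (fun u => g1 u + g2 u).
Proof.
move=> h1 h2 u w; rewrite opprD addrACA mulrDl.
by apply: le_trans (enormD _ _) _; rewrite lerD.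
Qed.

Lemma convex_gradient_monotone phi u w :
  convex_function [set: 'rV[R]_n] phi -> (forall z, differentiable phi z) ->
  0 <= dotv (u - w) (grad phi u - grad phi w).
Proof.
move=> cphi dphi; have := convex_gradient_le w cphi (dphi u).
have := convex_gradient_le u cphi (dphi w).
rewrite (dotvC (u - w)) !(dotvBl, dotvBr); lra.
Qed.

(** Difference quotients inherit monotonicity and the Lipschitz bound. As
    v = g (x) is known at nonnegative times only, the two-sided quotients are
    controlled for t > 0. *)
Lemma image_velocity (g : 'rV[R]_n -> 'rV[R]_n) k x v t : 0 < t ->
  elipschitz k g -> (forall u w, 0 <= dotv (u - w) (g u - g w)) ->
  (forall s, 0 <= s -> v s = g (x s)) ->
  derivable x t 1 -> derivable v t 1 ->
  0 <= dotv (derive1 x t) (derive1 v t) /\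
  enorm (derive1 v t) <= k * enorm (derive1 x t).
Proof.
move=> t0 gk gmono vg dx dv.
have qx := derive1_quotient dx; have qv := derive1_quotient dv.
have vgn : \forall h \near (0 : R)^', v (h + t) = g (x (h + t)).
  apply/nbhs_ballP; exists t => //= h; rewrite -ball_normE/= sub0r normrN => ht _.
  by rewrite vg//; move: ht; rewrite ltr_norml; lra.
have vgt := vg t (ltW t0); split.
  apply: cvgr_to_ge (cvg_dotv qx qv) _; apply: filterS vgn => h ->.
  by rewrite vgt dotvZl dotvZr mulrA -expr2 mulr_ge0 ?sqr_ge0.
apply: (ler_cvg_to (cvg_enorm qv) (cvgM (cvg_cst k) (cvg_enorm qx))).
apply: filterS vgn => h ->.
by rewrite /= vgt !enormZ [leRHS]mulrCA ler_wpM2l.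
Qed.

Lemma bounded_curve_limit_point x : [bounded x t | t in `[0, +oo[%classic] ->
  exists xbar, forall T e : R, 0 < e ->
    exists2 t : R, T <= t & enorm (x t - xbar) < e.
Proof.
move=> /pinfty_ex_gt0[M M0 xM].
pose A : set 'rV[R]_n := [set z | `|z| <= M].
have cA : compact A.
  apply: bounded_closed_compact.
    by exists M; split; [exact: num_real | move=> M' MM' z /= /le_trans; apply; exact: ltW].
  by apply: (closed_comp (f := fun z : 'rV[R]_n => `|z|) _ (@closed_le _ M)) => z _;
    exact: norm_continuous.
have [|xbar [_ cl]] := cA (x @ +oo) _.
  exists 0; split; first exact: num_real.
  by move=> t /ltW t0; apply: xM; rewrite /= in_itv/= t0.
exists xbar => T e e0.
have [_ [[t Tt <-] xt]] : [set x t | t in [set t | T <= t]] `&`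
    [set w | enorm (w - xbar) < e] !=set0.
  apply: cl; last exact: enorm_lt_nbhs.
  exists T; split; first exact: num_real.
  by move=> t /ltW Tt; exists t.
by exists t.
Qed.

Lemma bounded_curve_lipschitz f k x : (forall z, differentiable f z) ->
  elipschitz k (grad f) -> [bounded x t | t in `[0, +oo[%classic] ->
  exists2 G : R, 0 <= G & forall s t : R, 0 <= s -> 0 <= t ->
    `|f (x s) - f (x t)| <= G * enorm (x s - x t).
Proof.
move=> df fk /pinfty_ex_gt0[M M0 xM]; pose r := n%:R * M.
have r0 : 0 <= r by rewrite mulr_ge0// ltW.
have xr t : 0 <= t -> enorm (x t) <= r.
  move=> t0; apply: le_trans (enorm_le_normr _) _; rewrite ler_wpM2l//.
  by apply: xM; rewrite /= in_itv/= t0.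
exists (`|k| * r + enorm (grad f 0)); first by
  apply: addr_ge0; [exact: mulr_ge0 | exact: enorm_ge0].
move=> s t /xr xs /xr xt; apply: bounded_gradient_lipschitz xs xt => // z zr.
rewrite -[X in enorm X](subrK (grad f 0)); apply: le_trans (enormD _ _) _.
rewrite lerD2r; apply: le_trans (fk _ _) _; rewrite subr0.
apply: (@le_trans _ _ (`|k| * enorm z)); last by rewrite ler_wpM2l.
by rewrite ler_wpM2r ?enorm_ge0 ?ler_norm.
Qed.

(** Since grad f (x) = - (lambda x' + v'), monotonicity of grad phi yields the
    decrease and its Lipschitz constant the relative error. *)
Lemma dynamics_descent phi psi (rho L lambda : R) (x0 v0 : 'rV[R]_n) x v :
  convex_function [set: 'rV[R]_n] phi -> (forall u, differentiable phi u) ->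
  0 < rho -> elipschitz rho^-1 (grad phi) ->
  (forall u, differentiable psi u) -> elipschitz L (grad psi) -> 0 < lambda ->
  strong_global_solution phi psi lambda x0 v0 x v ->
  [bounded x t | t in `[0, +oo[%classic] -> has_lbound (range (phi \+ psi)) ->
  exists G ell : R,
    descent_curve (phi \+ psi) x lambda (lambda + rho^-1) G ell.
Proof.
move=> cphi dphi rho0 phi_lip dpsi psi_lip lam0 [[acx _] vphi ode _ _] xb [ell ellP].
have gradf u := gradD (dphi u) (dpsi u).
have df u : differentiable (phi \+ psi) u by exact: differentiableD.
have f_lip : elipschitz (rho^-1 + L) (grad (phi \+ psi)).
  by move=> u w; rewrite !gradf; exact: (elipschitzD phi_lip psi_lip).
have [G G0 fG] := bounded_curve_lipschitz df f_lip xb.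
exists G, ell; split => //.
- by rewrite addr_gt0// invr_gt0.
(* The time 0 is discarded: there the two-sided derivative sees negative times. *)
- have neg0 : (@lebesgue_measure R).-negligible [set 0].
    by apply/negligibleP; [exact: measurable_set1 | exact: lebesgue_measure_set1].
  apply: negligibleS (negligibleU ode neg0) => t /= nd.
  have [-> |t0] := eqVneq t 0; [by right | left] => h; apply: nd => tge0.
  have [dx dv eqn] := h tge0.
  have tgt0 : 0 < t by rewrite lt_def t0.
  have mono u w := convex_gradient_monotone u w cphi dphi.
  have [xv vle] := image_velocity tgt0 phi_lip mono vphi dx dv.
  have gE : grad (phi \+ psi) (x t) = - (lambda *: derive1 x t + derive1 v t).
    rewrite gradf -vphi//; apply/eqP; rewrite -addr_eq0; apply/eqP.
    by rewrite -[RHS]eqn addrC addrA.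
  split=> //.
    rewrite gE dotvNl lerN2 dotvDl dotvZl -sqr_enorm lerDl dotvC.
    exact: xv.
  rewrite gE enormN; apply: le_trans (enormD _ _) _.
  by rewrite enormZ gtr0_norm// mulrDl lerD2l.
- by move=> t _; apply: ellP; exists (x t).
Qed.

End dynamical_system.

Theorem theorem15 (R : realType) (n : nat) (phi psi : 'rV[R]_n -> R)
    (rho L lambda : R) (x0 v0 : 'rV[R]_n) (x v : R -> 'rV[R]_n)
    (hphi_convex : convex_function [set: 'rV[R]_n] phi)
    (hphi_diff : forall u : 'rV[R]_n, differentiable phi u)
    (hrho : 0 < rho)
    (hphi_lip : elipschitz rho^-1 (grad phi))
    (hpsi_diff : forall u : 'rV[R]_n, differentiable psi u)
    (hL : 0 < L)
    (hpsi_lip : elipschitz L (grad psi))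
    (hlambda : 0 < lambda)
    (hv0 : v0 = grad phi x0)
    (hsol : strong_global_solution phi psi lambda x0 v0 x v)
    (hx_bounded : [bounded x t | t in `[0, +oo[%classic])
    (hf_lower : has_lbound (range (phi \+ psi)))
    (hf_KL : KL_power_function (phi \+ psi)) :
  exists xbar : 'rV[R]_n,
    [/\ grad (phi \+ psi) xbar = 0,
        x t @[t --> +oo] --> xbar,
        v t @[t --> +oo] --> grad phi xbar,
        grad phi xbar = - grad psi xbar &
        forall theta : R, 0 < theta < 1 ->
          lojasiewicz_exponent (phi \+ psi) xbar theta ->
          exists a1 b1 a2 b2 t0 : R,
            [/\ 0 < a1, 0 < b1, 0 < a2, 0 < b2 & 0 <= t0] /\
            forall t : R, t0 <= t ->
              [/\ theta < 2^-1 ->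
                    converges_in_finite_time x xbar /\
                    converges_in_finite_time v (grad phi xbar),
                  theta = 2^-1 ->
                    enorm (x t - xbar) + enorm (v t - grad phi xbar)
                      <= a1 * expR (- (b1 * t)) &
                  2^-1 < theta ->
                    enorm (x t - xbar) + enorm (v t - grad phi xbar)
                      <= (a2 * t + b2)
                           `^ (- ((1 - theta) / (2 * theta - 1)))]].
Proof.
have [G [ell dc]] := dynamics_descent hphi_convex hphi_diff hrho hphi_lip
  hpsi_diff hpsi_lip hlambda hsol hx_bounded hf_lower.
have [xbar xbar_cluster] := bounded_curve_limit_point hx_bounded.
have x_cvg := kl_convergence dc xbar_cluster (hf_KL xbar).
have gradf u := gradD (hphi_diff u) (hpsi_diff u).
have cgrad : continuous (grad (phi \+ psi)).
  apply: (@elipschitz_continuous _ _ (rho^-1 + L)) => u w.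
  by rewrite !gradf; exact: (elipschitzD hphi_lip hpsi_lip).
have grad0 := gradient_limit0 dc xbar_cluster cgrad x_cvg.
have [_ vphi _ _ _] := hsol.
have xlim : x t @[t --> +oo] --> xbar.
  apply: cvg_enormP => e /x_cvg[T _ hT]; exists T; split; first exact: num_real.
  by move=> t /ltW /hT.
have vle t : 0 <= t -> enorm (v t - grad phi xbar) <= rho^-1 * enorm (x t - xbar).
  by move=> /vphi->.
exists xbar; split=> //.
- apply: cvg_enormP => e e0; have [T T0 hT] := x_cvg _ (mulr_gt0 hrho e0).
  exists T; split; first exact: num_real.
  move=> t /ltW Tt; apply: le_lt_trans (vle _ (le_trans T0 Tt)) _.
  by rewrite ltr_pdivrMl// hT.
- by apply/eqP; rewrite -addr_eq0 -gradf grad0.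
move=> theta th01 [C [eps [C0 eps0 loj]]].
have [B [b [T [B0 b0 T0 fin hB]]]] := lojasiewicz_rates dc x_cvg th01 C0 eps0 loj.
have rho10 : 0 < 1 + rho^-1 by rewrite ltr_pwDl// invr_ge0 ltW.
pose p := (1 - theta) / (2 * theta - 1).
(* c ^ (- p) = (1 + rho^-1) * B, so that c absorbs the factor into the base. *)
pose c := ((1 + rho^-1) * B) `^ (- p^-1).
have c0 : 0 < c by rewrite powR_gt0// mulr_gt0.
exists ((1 + rho^-1) * B), b, (c * b), (c * b), T; split.
  by split=> //; rewrite mulr_gt0.
move=> t Tt; have t0 := le_trans T0 Tt; have [exp_rate pow_rate] := hB t Tt.
have sumle : enorm (x t - xbar) + enorm (v t - grad phi xbar) <=
    (1 + rho^-1) * enorm (x t - xbar) by rewrite mulrDl mul1r lerD2l vle.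
split=> [th|th|th].
- have [S S0 hS] := fin th; split; exists S => // s Ss.
  by rewrite vphi ?hS// (le_trans S0).
- by apply: le_trans sumle _; rewrite -mulrA ler_wpM2l ?exp_rate// ltW.
- apply: le_trans sumle _.
  have p0 : p != 0.
    by case/andP: th01 => _ th1; rewrite gt_eqF// divr_gt0//; lra.
  rewrite -mulrA -mulrDr powRM ?(ltW c0)//; last first.
    by rewrite addr_ge0 ?mulr_ge0 ?(ltW b0).
  rewrite -/p /c -powRrM mulrNN mulVf// powRr1; last first.
    by rewrite mulr_ge0 ?(ltW B0) ?(ltW rho10).
  by rewrite -mulrA ler_wpM2l ?pow_rate// ltW.
Qed.
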